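(* Let $X$ be a first countable Hausdorff space in which all closed sets are separable, and let $\mathcal{I}\neq\mathrm{Fin}$ be an $F_\sigma$-ideal on $\mathbf{N}$. Let $B,C\subseteq X$ be closed sets such that $\emptyset\neq B\subseteq C$. Then there exists a sequence $x$ taking values in $X$ such that $\Lambda_x(\mathcal{I})=\Gamma_x(\mathcal{I})=B$ and $\mathrm{L}_x=C$.
   Context: $\mathbf{N}$ denotes the positive integers. An ideal $\mathcal{I}$ on $\mathbf{N}$ is a collection of subsets of $\mathbf{N}$ closed under finite unions and subsets; it is assumed to contain the family $\mathrm{Fin}$ of finite subsets of $\mathbf{N}$ and to be different from $\mathcal{P}(\mathbf{N})$. Identifying subsets of $\mathbf{N}$ with their characteristic functions, $\mathcal{P}(\mathbf{N})$ carries the Cantor-space topology of $\{0,1\}^{\mathbf{N}}$; an $F_\sigma$-ideal is an ideal which is an $F_\sigma$-subset of this space. For a sequence $x=(x_n)_{n\in\mathbf{N}}$ in $X$: $\Lambda_x(\mathcal{I})$ (the $\mathcal{I}$-limit points) is the set of all $\ell\in X$ such that $\lim_{k\to\infty}x_{n_k}=\ell$ for some subsequence $(x_{n_k})$ with $\{n_k:k\in\mathbf{N}\}\notin\mathcal{I}$. $\Gamma_x(\mathcal{I})$ (the $\mathcal{I}$-cluster points) is the set of all $\ell\in X$ such that $\{n:x_n\in U\}\notin\mathcal{I}$ for every neighborhood $U$ of $\ell$. $\mathrm{L}_x:=\Lambda_x(\mathrm{Fin})=\Gamma_x(\mathrm{Fin})$ is the set of ordinary limit points of $x$, i.e. limits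 of convergent subsequences. *)

(* Defs.v *)
From HB Require Import structures.
From mathcomp Require Import all_boot all_order all_algebra.
From mathcomp Require Import all_classical all_reals all_analysis.
From mathcomp Require Import borel_hierarchy.

Set Implicit Arguments.
Unset Strict Implicit.
Unset Printing Implicit Defensive.

Local Open Scope classical_set_scope.

(* The positive integers are represented by [nat], via n |-> n - 1: none of the
   notions below depends on where the indexing starts. *)

Definition Fin : set (set nat) := [set A | finite_set A].

(* The empty union is covered by [ideal_fin]. *)
Record is_ideal (I : set (set nat)) : Prop := IsIdeal {
  ideal_sub : forall S T : set nat, I T -> S `<=` T -> I S ;
  ideal_setU : forall S T : set nat, I S -> I T -> I (S `|` T) ;
  ideal_fin : Fin `<=` I ;
  ideal_proper : I <> [set: set nat] }.

Definition char_fun (A : set nat) : cantor_space := fun n => n \in A.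

Definition is_Fsigma_ideal (I : set (set nat)) : Prop :=
  is_ideal I /\ Fsigma (char_fun @` I).

Section LimitAndClusterPoints.
Context {X : topologicalType}.
Implicit Types (x : nat -> X) (I : set (set nat)).

Definition limit_points x I : set X :=
  [set l | exists k : nat -> nat,
     [/\ increasing_seq k, ~ I (range k) & (x \o k) i @[i --> \oo] --> l]].

Definition cluster_points x I : set X :=
  [set l | forall U : set X, nbhs l U -> ~ I [set n | U (x n)]].

Definition ordinary_limit_points x : set X := limit_points x Fin.

End LimitAndClusterPoints.

Definition first_countable (X : topologicalType) : Prop :=
  forall p : X, exists2 V : set (set X), countable V &
    V `<=` nbhs p /\ forall U, nbhs p U -> exists2 W, V W & W `<=` U.

(* [D] is dense in [F] for the subspace topology. The library's [subspace F]
   keeps the points outside [F] as isolated points, so [dense] cannot be used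
   on it. *)
Definition separable_set (X : topologicalType) (F : set X) : Prop :=
  exists2 D : set X, countable D & D `<=` F /\ F `<=` closure D.

(* Main.v *)
(* An F_sigma ideal [I] is an increasing union of closed sets [F k], and a set
   outside [F k] is kept outside [F k] by finitely many of its elements.  Hence,
   given positive sets [S k], one can cut [nat] into consecutive blocks such
   that every set agreeing with [S k] on the [k]-th block for infinitely many
   [k] is positive.  This splits a positive set into infinitely many positive
   pieces, and diagonalises a decreasing sequence of positive sets, so that
   cluster points are limit points; both apply to [Fin] as well as to [I].  It
   remains to pick an infinite [A] in [I], and to let [x] run through a dense
   sequence of [C] on infinite pieces of [A], and through a dense sequence of
   [B] on positive pieces of the complement of [A]. *)
Require Import Defs.
From mathcomp Require Import all_boot all_order all_algebra.
From mathcomp Require Import all_classical all_reals all_analysis.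
From mathcomp Require Import borel_hierarchy.
From mathcomp Require Import finmap zify.

Set Implicit Arguments.
Unset Strict Implicit.

Local Open Scope classical_set_scope.

(** * Closed exhaustions of ideals *)

Definition agree_on (N M : nat) (S T : set nat) : Prop :=
  forall i, N <= i < M -> T i <-> S i.

(* Closedness in the Cantor space, expressed with initial segments. *)
Definition finitely_refutable (F : set (set nat)) : Prop :=
  forall S, ~ F S -> exists M, forall T, agree_on 0 M S T -> ~ F T.

(** Since the family increases, a set avoiding [F k] for arbitrarily large [k] is outside [I]. *)
Definition closed_exhaustion (I : set (set nat)) (F : nat -> set (set nat)) :=
  [/\ forall j, F j `<=` I, forall S, I S -> exists j, F j S,
      forall j k, j <= k -> F j `<=` F k &
      forall j, finitely_refutable (F j)].

Lemma char_funE (A : set nat) i : char_fun A i = true <-> A i.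
Proof. by rewrite /char_fun; split=> [/set_mem|/mem_set]. Qed.

Lemma char_fun_inj : injective char_fun.
Proof.
move=> S T ST; apply/seteqP; split=> i /char_funE; first by rewrite ST => /char_funE.
by rewrite -ST => /char_funE.
Qed.

(** Otherwise some [T M] in the closed set agrees with [S] below [M] for each [M]; these converge
    pointwise to [S], which would then belong to it. *)
Lemma closed_finitely_refutable (G : set cantor_space) :
  closed G -> finitely_refutable [set S | G (char_fun S)].
Proof.
move=> Gcl S nGS; apply: contrapT => /forallNP noM.
have /choice[T TP] : forall M, exists T, agree_on 0 M S T /\ G (char_fun T).
  by move=> M; have /existsNP[T /not_implyP[ag /contrapT GT]] := noM M; exists T.
apply: nGS; apply: (@closed_cvg nat cantor_space \oo _ (char_fun \o T) G) => //.
  by near=> M; case: (TP M).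
apply/(@pointwise_cvgP nat bool) => i.
suff : char_fun (T M) i @[M --> \oo] --> char_fun S i by [].
apply: cvg_near_cst; near=> M.
have Mi : i < M by near: M; exact: nbhs_infty_gt.
have [ag _] := TP M; apply/idP/idP => /char_funE.
  by move/(ag i) => h; apply/char_funE/h.
by move=> Si; apply/char_funE/(ag i).
Unshelve. all: by end_near.
Qed.

Lemma Fsigma_exhaustion (I : set (set nat)) :
  is_Fsigma_ideal I -> exists F, closed_exhaustion I F.
Proof.
move=> [_ [G Gcl IG]].
(* Finite unions make the family increasing while keeping its members closed. *)
exists (fun j => [set S | (\bigcup_(i in `I_j.+1) G i) (char_fun S)]); split.
- move=> j S [i _ GiS].
  have : (char_fun @` I) (char_fun S) by rewrite IG; exists i.
  by case=> T IT /char_fun_inj <-.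
- move=> S IS; have : (char_fun @` I) (char_fun S) by exists S.
  by rewrite IG => -[j _ GjS]; exists j => /=; exists j => /=.
- move=> j k jk S [i /= ij GS]; exists i => //=; lia.
- move=> j; apply: closed_finitely_refutable.
  by apply: closed_bigcup => //; exact: finite_II.
Qed.

Lemma is_ideal_Fin : is_ideal Fin.
Proof.
split=> //.
- by move=> S T fS TS; exact: sub_finite_set TS fS.
- by move=> S T fS fT; rewrite /Fin /= finite_setU.
- move=> FinT; apply: infinite_nat.
  by have : Fin setT by rewrite FinT.
Qed.

Lemma Fin_exhaustion : closed_exhaustion Fin (fun j => [set S | S `<=` `I_j]).
Proof.
split.
- by move=> j S /sub_finite_set; apply; exact: finite_II.
- move=> S /finite_fsetP[X ->]; exists (\max_(i <- X) i).+1 => i /= iX.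
  by rewrite ltnS; exact: leq_bigmax_seq.
- by move=> j k jk S Sj i /Sj /=; lia.
- move=> j S /existsNP[i /not_implyP[Si /= ij]].
  by exists i.+1 => T ag Tj; apply/ij/Tj/ag; rewrite //=; lia.
Qed.

(** * Positive sets and blocks *)

Section Ideal.
Variables (I : set (set nat)) (F : nat -> set (set nat)).
Hypotheses (idI : is_ideal I) (exF : closed_exhaustion I F).

Lemma ideal_finite (S : set nat) : finite_set S -> I S.
Proof. exact: ideal_fin. Qed.

Lemma ideal_not_setC (A : set nat) : I A -> ~ I (~` A).
Proof.
move=> IA IcA; apply: (ideal_proper idI); apply/seteqP; split=> // S _.
by apply: (ideal_sub idI (ideal_setU idI IA IcA)); rewrite setUv.
Qed.

(** Altering [S] below [N] keeps it positive, so each of the finitely many traces of [T] below [N]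
    yields a bound that refutes [F j]; the largest one serves. The induction decides whether [N] is
    in [T]. *)
Lemma positive_avoids (j N : nat) (S : set nat) : ~ I S ->
  exists2 M, N <= M & forall T, agree_on N M S T -> ~ F j T.
Proof.
have [FI _ _ Fref] := exF.
elim: N S => [|N IH] S nIS.
  have [|M HM] := Fref j S; first by move/FI.
  by exists M.
have [|M1 NM1 H1] := IH (N |` S).
  by move=> /(ideal_sub idI) IS; apply/nIS/IS => i; right.
have [|M2 NM2 H2] := IH (S `\ N).
  move=> IS; apply: nIS.
  apply: (ideal_sub idI (ideal_setU idI IS (ideal_finite (finite_set1 N)))) => i Si.
  by have [->|/eqP iN] := eqVneq i N; [right|left].
exists (maxn N.+1 (maxn M1 M2)); first by rewrite leq_maxl.
move=> T ag; have [TN|TN] := pselect (T N).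
  apply: H1 => i iM; have [->|/eqP iN] := eqVneq i N.
    by split=> // _; left.
  have /ag -> : N.+1 <= i < maxn N.+1 (maxn M1 M2) by lia.
  by split=> [|[|//]]; [right|].
apply: H2 => i iM; have [->|/eqP iN] := eqVneq i N.
  by split=> // -[_] /(_ erefl).
have /ag -> : N.+1 <= i < maxn N.+1 (maxn M1 M2) by lia.
by split=> // -[].
Qed.

(** Block [k] starts where the previous one ends and is long enough that agreeing with [S k] on it
    excludes membership in [F k], whatever happens below. *)
Lemma positive_blocks (S : nat -> set nat) : (forall k, ~ I (S k)) ->
  exists2 M : nat -> nat, {homo M : i j / i <= j} &
    forall T, (forall j, exists2 k, j <= k & agree_on (M k) (M k.+1) (S k) T) ->
      ~ I T.
Proof.
move=> nIS; have [_ IF Fmono _] := exF.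
have /choice[h hP] : forall kN : nat * nat, exists M, kN.2 <= M /\
    forall T, agree_on kN.2 M (S kN.1) T -> ~ F kN.1 T.
  by move=> [k N]; have [M NM HM] := positive_avoids k N (nIS k); exists M.
pose M := fix M k := if k is k'.+1 then h (k', M k') else 0.
exists M.
  apply: homo_leq => [//|i j k|k]; first exact: leq_trans.
  by have [] := hP (k, M k).
move=> T HT IT; have [j FjT] := IF _ IT; have [k jk ag] := HT j.
by have [_ /(_ T ag)] := hP (k, M k); apply; exact: Fmono jk _ _.
Qed.

Lemma block_unique (M : nat -> nat) i j k : {homo M : i j / i <= j} ->
  M j <= i < M j.+1 -> M k <= i < M k.+1 -> j = k.
Proof.
move=> Mmono ij ik; have [jk|kj|//] := ltngtP j k.
  by have := Mmono _ _ jk; lia.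
by have := Mmono _ _ kj; lia.
Qed.

Lemma positive_split (E : set nat) : ~ I E ->
  exists p : nat -> nat, forall n, ~ I [set i | E i /\ p i = n].
Proof.
move=> nIE; have [M Mmono HM] := positive_blocks (S := fun=> E) (fun=> nIE).
(* The default [0] is harmless: agreement is only tested at points of a block. *)
pose blk i := xget 0 [set k | M k <= i < M k.+1].
have blkE i k : M k <= i < M k.+1 -> blk i = k.
  move=> ik; apply: (block_unique Mmono _ ik).
  by apply: (@xgetPex _ 0 [set k | M k <= i < M k.+1]); exists k.
(* Every [n] is the 2-adic valuation of [k.+1] for infinitely many [k]. *)
exists (fun i => logn 2 (blk i).+1) => n.
(* This [k] is at least [j], and [k.+1] is [2 ^ n] times an odd number. *)
apply: HM => j; exists (2 ^ n * j.*2.+1).-1.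
  rewrite -ltnS prednK ?muln_gt0 ?expn_gt0 //.
  by apply: leq_trans (leq_pmull _ _); rewrite ?expn_gt0 // -addnn; lia.
move=> i /blkE bi; split=> [[]//|Ei]; split=> //.
rewrite bi prednK ?muln_gt0 ?expn_gt0 // mulnC logn_Gauss ?pfactorK //.
by rewrite prime_coprime // dvdn2 /= odd_double.
Qed.

End Ideal.

(** * Enumerations *)

Lemma infinite_enumeration (S : set nat) : infinite_set S ->
  exists2 k : nat -> nat, increasing_seq k & range k = S.
Proof.
move=> Sinf.
have nextP m : exists n, (m <= n) && (n \in S).
  apply: contrapT => /forallNP none; apply: Sinf.
  apply: (sub_finite_set _ (finite_II m)) => n Sn /=.
  by have := none n; rewrite (mem_set Sn) andbT => /negP; rewrite -ltnNge.
pose next m := ex_minn (nextP m).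
have next_ge m : m <= next m by rewrite /next; case: ex_minnP => n /andP[].
have next_mem m : S (next m).
  by rewrite /next; case: ex_minnP => n /andP[_ /set_mem].
have next_min m n : m <= n -> S n -> next m <= n.
  move=> mn Sn; rewrite /next; case: ex_minnP => l _; apply.
  by rewrite mn mem_set.
pose k := fix k n := if n is n'.+1 then next (k n').+1 else next 0.
have kS n : k n < k n.+1 by exact: next_ge.
exists k; first by apply/increasing_seqP.
apply/seteqP; split=> [_ [n _ <-]|s Ss]; first by case: n => [|n]; exact: next_mem.
(* The least next element never jumps over a missed [s], so [k] would be bounded by [s], although
   [n <= k n]. *)
apply: contrapT => nks.
have ks n : k n <= s.
  elim: n => [|n IH]; first exact: next_min.
  apply: next_min => //; rewrite ltn_neqAle IH andbT.
  by apply/eqP => kns; apply: nks; exists n.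
have kn n : n <= k n by elim: n => // n IH; exact: leq_ltn_trans IH (kS n).
by have := leq_trans (kn s.+1) (ks s.+1); rewrite ltnn.
Qed.

Lemma countable_enumeration (T : Type) (D : set T) : countable D -> D !=set0 ->
  exists d : nat -> T, range d = D.
Proof.
move=> /pfcard_geP[->[]//|[d] _]; exists d.
by rewrite image_eq.
Qed.

(** * Limit points and cluster points *)

Section Points.
Context {X : topologicalType}.

Lemma first_countable_decreasing_base (p : X) : first_countable X ->
  exists U : nat -> set X, [/\ forall k, nbhs p (U k),
    forall j k, j <= k -> U k `<=` U j &
    forall W, nbhs p W -> exists j, U j `<=` W].
Proof.
move=> /(_ p)[V Vc [Vp Vbase]].
have V0 : V !=set0 by have [W VW _] := Vbase _ filterT; exists W.
have [v rv] := countable_enumeration Vc V0.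
pose U := fix U k := if k is k'.+1 then U k' `&` v k'.+1 else v 0.
have nv k : nbhs p (v k) by apply: Vp; rewrite -rv; exists k.
exists U; split.
- by elim=> [|k IH]; [exact: nv|exact: filterI].
- move=> j k; elim: k => [|k IH]; first by rewrite leqn0 => /eqP ->.
  rewrite leq_eqVlt => /predU1P[->//|jk]; exact: subset_trans (@subIsetl _ _ _) (IH jk).
- move=> W /Vbase[W']; rewrite -rv => -[j _ <-] vW; exists j.
  by apply: subset_trans vW; case: j => // j; exact: subIsetr.
Qed.

Section PointsOfIdeal.
Variables (I : set (set nat)) (F : nat -> set (set nat)).
Hypotheses (idI : is_ideal I) (exF : closed_exhaustion I F).

Lemma limit_points_sub_cluster (x : nat -> X) :
  limit_points x I `<=` cluster_points x I.
Proof.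
move=> l [k [_ nIk xkl]] U Ul IU; apply: nIk.
have [N _ HN] := xkl _ Ul.
apply: (ideal_sub idI (ideal_setU idI IU
  (ideal_finite idI (finite_image k (finite_II N))))).
move=> _ [i _ <-]; have [iN|Ni] := ltnP i N; first by right; exists i.
by left; exact: HN.
Qed.

Lemma cluster_points_sub_limit (x : nat -> X) : first_countable X ->
  cluster_points x I `<=` limit_points x I.
Proof.
move=> fcX l lx; have [U [nU Udec Ubase]] := first_countable_decreasing_base l fcX.
pose S k : set nat := [set n | U k (x n)].
have [M Mmono HM] := positive_blocks idI exF (S := S) (fun k => lx _ (nU k)).
(* [T] agrees with [S k] on every block [k], hence is positive. *)
pose T : set nat := [set n | exists k, M k <= n < M k.+1 /\ S k n].
have nIT : ~ I T.
  apply: HM => j; exists j => // i ij; split=> [[k [ik Ski]]|Sji].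
    by rewrite (block_unique Mmono ij ik).
  by exists j.
have [|k kinc rk] := @infinite_enumeration T.
  by move=> /(ideal_finite idI).
exists k; split=> //; first by rewrite rk.
(* For [i >= M j], the index [k i >= i] lies in a block [m >= j], so [x] is there in [U m], hence in
   [U j]. *)
move=> W /Ubase[j UW]; exists (M j) => // i /= ji.
have /= : T (k i) by rewrite -rk; exists i.
move=> [m [km Smk]]; apply: UW; apply: (Udec j m) Smk.
have kge n : n <= k n.
  elim: n => // n IH; apply: leq_ltn_trans IH _.
  by have /increasing_seqP := kinc; apply.
rewrite leqNgt; apply/negP => mj.
by have := Mmono _ _ mj; have := kge i; lia.
Qed.

Lemma limit_points_eq_cluster (x : nat -> X) : first_countable X ->
  limit_points x I = cluster_points x I.
Proof.
move=> fcX; apply/seteqP.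
by split; [exact: limit_points_sub_cluster|exact: cluster_points_sub_limit].
Qed.

(** The complement of [B] is open and visited only along a set in [I]; a neighbourhood of a point of
    [B] contains some [d m], a value taken on the positive set [P m]. *)
Lemma cluster_points_eq_closed (x : nat -> X) (P : nat -> set nat) (d : nat -> X)
    (B : set X) :
  closed B -> I [set n | ~ B (x n)] -> B `<=` closure (range d) ->
  (forall m, ~ I (P m)) -> (forall m n, P m n -> x n = d m) ->
  cluster_points x I = B.
Proof.
move=> Bcl IB Bd nIP Pd; apply/seteqP; split=> l.
  move=> lx; apply: contrapT => nBl; apply: (lx (~` B)) => //.
  by apply: open_nbhs_nbhs; split=> //; exact: closed_openC.
move=> /Bd dl U /dl[_ [[m _ <-] Udm]] /(ideal_sub idI) IU.
by apply: (nIP m); apply: IU => n /= /Pd ->.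
Qed.

End PointsOfIdeal.

Lemma closed_dense_sequence (B : set X) : separable_set B -> B !=set0 ->
  exists d : nat -> X, (forall n, B (d n)) /\ B `<=` closure (range d).
Proof.
move=> [D Dc [DB BD]] [b Bb].
have D0 : D !=set0 by have [d [Dd _]] := BD _ Bb _ filterT; exists d.
have [d rd] := countable_enumeration Dc D0.
by exists d; split; [move=> n; apply: DB; rewrite -rd; exists n|rewrite rd].
Qed.

End Points.

(** * Construction of the sequence *)

Unset Implicit Arguments.

Theorem theorem3p4 (X : topologicalType)
  (X_fc : first_countable X) (X_haus : hausdorff_space X)
  (X_sep : forall F : set X, closed F -> separable_set F)
  (I : set (set nat)) (I_Fsigma : is_Fsigma_ideal I) (I_neq_Fin : I <> Fin)
  (B C : set X) (B_closed : closed B) (C_closed : closed C)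
  (B_neq0 : B !=set0) (B_sub_C : B `<=` C) :
  exists x : nat -> X,
    [/\ limit_points x I = B,
        cluster_points x I = B &
        ordinary_limit_points x = C].
Proof.
have [idI _] := I_Fsigma; have [F exF] := Fsigma_exhaustion I_Fsigma.
have C_neq0 : C !=set0 by case: B_neq0 => b /B_sub_C; exists b.
have [b [Bb Bdense]] := closed_dense_sequence (X_sep _ B_closed) B_neq0.
have [c [Cc Cdense]] := closed_dense_sequence (X_sep _ C_closed) C_neq0.
have [A IA Ainf] : exists2 A, I A & infinite_set A.
  apply: contrapT => noA; apply: I_neq_Fin; apply/seteqP; split.
    by move=> A IA; apply: contrapT => Ainf; apply: noA; exists A.
  exact: ideal_fin idI.
have [p pP] := positive_split idI exF (ideal_not_setC idI IA).
have [q qP] := positive_split is_ideal_Fin Fin_exhaustion Ainf.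
pose x n := if n \in A then c (q n) else b (p n).
have xI : cluster_points x I = B.
  apply: (cluster_points_eq_closed idI B_closed _ Bdense pP).
    (* Values outside [B] occur only at indices in [A], which belongs to [I]. *)
    apply: (ideal_sub idI IA) => n /=; rewrite /x.
    by case: ifPn => [/set_mem//|_ []].
  by move=> m n [/= nA <-]; rewrite /x memNset.
have xFin : cluster_points x Fin = C.
  apply: (cluster_points_eq_closed is_ideal_Fin C_closed _ Cdense qP).
    apply: (ideal_finite is_ideal_Fin).
    (* Both [b] and [c] stay in [C], so no index is exceptional. *)
    rewrite (_ : [set _ | _] = set0); first exact: finite_set0.
    apply/seteqP; split=> // n /=; rewrite /x.
    by case: ifPn => _ []; [exact: Cc|exact/B_sub_C/Bb].
  by move=> m n [/= nA <-]; rewrite /x mem_set.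
exists x; split=> //.
  by rewrite (limit_points_eq_cluster idI exF).
by rewrite /ordinary_limit_points (limit_points_eq_cluster is_ideal_Fin Fin_exhaustion).
Qed.
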